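(* Let $N \geq 1$ and $0 \leq k \leq N-1$. There are exactly $C_{N-1}$ permutations of size $N$ that are $231$-avoiding and $k$-winnable.
   Context: $C_n = \frac{1}{n+1}\binom{2n}{n}$ denotes the $n$th Catalan number. A permutation of size $N$ is an arrangement $p_1 p_2 \cdots p_N$ of the values $1,2,\ldots,N$. A permutation $p$ contains the pattern $q = q_1q_2q_3$ if there exist $i<j<k$ such that $p_i,p_j,p_k$ are in the same relative order as $q_1,q_2,q_3$; otherwise $p$ is $q$-avoiding. A left-to-right maximum of $p$ is an entry $p_j$ with $p_j > p_i$ for all $i<j$. A permutation $p$ of size $N$ is $k$-winnable if rejecting $p_1,\ldots,p_k$ and then accepting the next left-to-right maximum of $p$ in a position $>k$ selects the value $N$; that is, $N$ lies in a position $>k$ and is the first left-to-right maximum among the positions $k+1,k+2,\ldots,N$. *)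

(* Defs.v *)
From mathcomp Require Import all_boot all_fingroup.

Set Implicit Arguments.
Unset Strict Implicit.
Unset Printing Implicit Defensive.

(* A permutation p_1 ... p_N of 1, ..., N is encoded as p : 'S_N, everything
   shifted down by one: p_(i+1) = (p i).+1 for i : 'I_N. *)

(* The quotient is exact: see catalan_mul. *)
Definition catalan (n : nat) : nat := 'C(2 * n, n) %/ n.+1.

Lemma catalan_mul (n : nat) : n.+1 * catalan n = 'C(2 * n, n).
Proof.
rewrite /catalan mulnC divnK //.
have := mul_bin_left (2 * n) n.
rewrite mul2n -addnn addnK => h.
have : n.+1 %| n * 'C(n + n, n) by rewrite -h dvdn_mulr.
by rewrite Gauss_dvdr // coprimeSn.
Qed.

(* p contains the pattern q1 q2 q3, whose entries are distinct. *)
Definition contains (N : nat) (p : 'S_N) (q1 q2 q3 : nat) : bool :=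
  [exists i : 'I_N, exists j : 'I_N, exists k : 'I_N,
    [&& i < j, j < k,
        (p i < p j) == (q1 < q2),
        (p i < p k) == (q1 < q3)
      & (p j < p k) == (q2 < q3)]].

Definition avoids (N : nat) (p : 'S_N) (q1 q2 q3 : nat) : bool :=
  ~~ contains p q1 q2 q3.

Definition lr_max (N : nat) (p : 'S_N) (j : 'I_N) : bool :=
  [forall i : 'I_N, (i < j) ==> (p i < p j)].

(* j is the index of the first left-to-right maximum after the first k
   positions (k <= j, since j stands for position j + 1), and its entry
   is the value N. *)
Definition winnable (N k : nat) (p : 'S_N) : bool :=
  [exists j : 'I_N,
    [&& k <= j,
        lr_max p j,
        [forall i : 'I_N, (k <= i < j) ==> ~~ lr_max p i]
      & (p j).+1 == N]].

(* Main.v *)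
Require Import Defs.
From mathcomp Require Import all_boot all_fingroup.
From mathcomp Require Import all_algebra ring zify.

(** Write a permutation of [0, n] as a word.  If it avoids 231, every entry to
the left of its maximum [n] is smaller than every entry to the right: otherwise
the two of them form a 231 with [n].  So the word is [L n R'], where [L] is a
231-avoiding word on [0, j), [j] is the position of [n], and [R'] is a
231-avoiding word [R] on [0, n - j) shifted by [j]; conversely every such pair
[(L, R)] occurs ([count_words]).  This gives the Catalan recurrence for the
number [c n] of 231-avoiding words of length [n] ([size_words]).

Being [k]-winnable reads off this decomposition.  The left-to-right maxima of
the word before position [j] are those of [L], and the last one of them is the
maximum of [L], the value [j - 1].  Hence the word is [k]-winnable iff [j = k],
or [k < j] and [j - 1] lies in one of the first [k] positions
([winnable_selects]).

The number of such words does not depend on [k].  Compare [k] with [k + 1]: the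
words won for [k] but not for [k + 1] are those with [j = k], and there are
[c k * c (n - k)] of them.  The words won for [k + 1] but not for [k] are those
with [k < j] where [j - 1] is in position [k].  Here [L] splits again at its
maximum, as [A (j - 1) B'] with [A] of length [k], so their number is the sum
over [j > k] of [c k * c (j - 1 - k) * c (n - j)], which the recurrence
collapses to [c k * c (n - k)] as well ([count_left_max]).  In terms of words,
[A (j - 1) B' n R'] corresponds to a word with [n] in position [k], the two
blocks [B] and [R] being reassembled around their own maximum.  Finally, for
[k = 0] the condition says that the word starts with [n], which leaves [c n]
choices ([count_selects]). *)

(** * The Catalan recurrence *)

Lemma central_binomialS n : n.+1 * 'C(2 * n.+1, n.+1) = 2 * (2 * n + 1) * 'C(2 * n, n).
Proof.
have e : (2 * n + 1).+1 = 2 * n.+1 by lia.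
have h1 := mul_bin_diag (2 * n + 1).+1 n.
have h2 := mul_bin_diag (2 * n).+1 n.
have h3 : 'C((2 * n).+1, n.+1) = 'C((2 * n).+1, n).
  by rewrite -bin_sub; [congr 'C(_, _); lia | lia].
rewrite /= h3 in h2. rewrite /= addn1 in h1.
rewrite -e addn1 -h1 (_ : (2 * n).+2 = 2 * n.+1); last by lia.
by rewrite -!mulnA -h2.
Qed.

Section Convolution.
Import GRing.Theory Num.Theory.
Local Open Scope ring_scope.

Let cbin (n : nat) : rat := 'C(2 * n, n)%:R.

Let cbinS n : cbin n.+1 = cbin n * (2 * (2 * n%:R + 1)) / (n%:R + 1).
Proof.
have n1 : n%:R + 1 != 0 :> rat by rewrite natr1 pnatr_eq0.
have := congr1 (fun m : nat => m%:R : rat) (central_binomialS n).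
rewrite !natrM natrD natrM -natr1 -/(cbin n) -/(cbin n.+1) => h.
by apply: (mulfI n1); rewrite h; field.
Qed.

Let catalanE n : (catalan n)%:R = cbin n / (n%:R + 1).
Proof.
have n1 : n%:R + 1 != 0 :> rat by rewrite natr1 pnatr_eq0.
apply: (mulfI n1); rewrite /cbin -catalan_mul natrM -natr1; field; exact: n1.
Qed.

(** The convolution telescopes: up to the factor
[2 (n + 1) (n + 2)], the summand [catalan i * catalan (n - i)] is the difference
between [i + 1] and [i] of the product of the central binomial coefficients of
[i] and [n + 1 - i] with [2 i - n - 1], a certificate found by Gosper's
algorithm.  The difference of the two boundary values is
[catalan n.+1]. *)
Lemma catalanS n : catalan n.+1 = (\sum_(i < n.+1) catalan i * catalan (n - i))%N.
Proof.
pose G i : rat :=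
  cbin i * cbin (n.+1 - i) * (2 * i%:R - n.+1%:R) / (2 * n.+1%:R * (n.+1%:R + 1)).
have n1 m : m%:R + 1 != 0 :> rat by rewrite natr1 pnatr_eq0.
have step i : (i < n.+1)%N -> (catalan i)%:R * (catalan (n - i))%:R = G i.+1 - G i.
  move=> le_i; rewrite /G subSS (subSn (le_i : (i <= n)%N)) !catalanE !cbinS.
  have {}le_i : (i <= n)%N := le_i.
  have -> : n.+1%:R = i%:R + (n - i)%:R + 1 :> rat.
    by rewrite -natrD subnKC // natr1.
  move: (n1 i) (n1 (n - i)%N); move: (n - i)%N => m im mm.
  rewrite -natr1; field; rewrite im mm /= -natrD.
  by rewrite (n1 _) -(natrD _ _ 1) -(natrD _ _ 1) pnatr_eq0 addn1.
apply/eqP; rewrite -(eqr_nat rat) natr_sum; apply/eqP.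
under eq_bigr => i _ do rewrite natrM step //.
rewrite -(big_mkord xpredT (fun i => G i.+1 - G i)) telescope_sumr // /G subnn subn0.
rewrite catalanE (_ : cbin 0 = 1) //.
have := n1 n; have := n1 n.+1; rewrite -natr1 => a b; field; rewrite a b //.
Qed.

End Convolution.

(** * 231-avoiding words *)

(** Avoidance of 231, split on the entry playing the role of 2; in this form it
can be computed along a concatenation. *)
Fixpoint av (s : seq nat) : bool :=
  if s is a :: s' then pairwise (fun b c => ~~ (c < a < b)) s' && av s' else true.

Lemma avP (s : seq nat) :
  reflect (forall i j k, i < j < k -> k < size s ->
             ~~ (nth 0 s k < nth 0 s i < nth 0 s j))
          (av s).
Proof.
elim: s => [|a s IHs] /=; first by left=> i j k _; rewrite ltn0.
apply: (iffP andP) => [[/(pairwiseP 0) has /IHs avs]|avs].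
  move=> [|i] [|j] [|k] //= ltij ltk; first by apply: has; rewrite ?inE; lia.
    by rewrite ltn0 andbF in ltij.
  exact: avs.
split.
  by apply/(pairwiseP 0) => j k; rewrite !inE => ltj ltk ltjk; apply: (avs 0 j.+1 k.+1); lia.
by apply/IHs => i j k ltijk ltk; apply: (avs i.+1 j.+1 k.+1); lia.
Qed.

Lemma av_addn j s : av (map (addn j) s) = av s.
Proof.
elim: s => //= a s ->; congr (_ && _); rewrite pairwise_map.
by apply: eq_pairwise => b c /=; rewrite !ltn_add2l.
Qed.

(** As [n] can only play the 3, a pattern 231 that does not lie within one side
of [n] has its 2 on the left and its 1 on the right; conversely, a larger entry
on the left and a smaller one on the right form a 231 with [n]. *)
Lemma av_max n (l r : seq nat) : {in l, forall x, x < n} -> {in r, forall x, x < n} ->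
  av (l ++ n :: r) = [&& allrel leq l r, av l & av r].
Proof.
move=> ltl ltr; elim: l ltl => [_|a l IHl] /=.
  suff -> : pairwise (fun b c => ~~ (c < n < b)) r by [].
  apply/(pairwiseP 0) => i j; rewrite !inE => lti ltj _.
  have lt_in : nth 0 r i < n by apply: ltr; apply: mem_nth.
  by rewrite (ltnNge n) (ltnW lt_in) andbF.
move=> ltl; have ltan := ltl a (mem_head _ _).
rewrite IHl => [|x xl]; last by apply: ltl; rewrite inE xl orbT.
rewrite pairwise_cat pairwise_cons allrel_consl allrel_consr.
have -> : all (fun c => ~~ (c < a < n)) r = all (leq a) r.
  by apply: eq_all => c /=; rewrite ltan andbT -leqNgt.
have -> : all (fun b => ~~ (n < a < b)) l.
  by apply/allP => b _; lia.
case: (boolP (all (leq a) r)) => [lear|_]; last by rewrite !(andbF, andFb).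
have -> : allrel (fun b c => ~~ (c < a < b)) l r.
  by apply/allrelP => b c _ /(allP lear) /=; lia.
have -> : pairwise (fun b c => ~~ (c < a < b)) r.
  apply/(pairwiseP 0) => i j; rewrite !inE => _ ltj _.
  have le_aj : a <= nth 0 r j by apply: (allP lear); apply: mem_nth.
  by rewrite ltnNge le_aj.
rewrite /= !andbT; case: (pairwise _ l); rewrite ?andbF //=.
Qed.

Definition words n : seq (seq nat) := [seq w <- permutations (iota 0 n) | av w].

Lemma mem_words n w : (w \in words n) = av w && perm_eq w (iota 0 n).
Proof. by rewrite mem_filter mem_permutations. Qed.

Lemma uniq_words n : uniq (words n).
Proof. by rewrite filter_uniq // permutations_uniq. Qed.

Lemma size_word {n w} : perm_eq w (iota 0 n) -> size w = n.
Proof. by move/perm_size; rewrite size_iota. Qed.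

Lemma word_lt {n} {w : seq nat} : perm_eq w (iota 0 n) -> {in w, forall x, x < n}.
Proof. by move=> pw x; rewrite (perm_mem pw) mem_iota. Qed.

Lemma perm_cat_max n (l r : seq nat) :
  perm_eq (l ++ n :: r) (iota 0 n.+1) = perm_eq (l ++ r) (iota 0 n).
Proof.
rewrite -addn1 iotaD add0n -cat1s perm_catCA perm_sym perm_catC.
by rewrite perm_cons perm_sym.
Qed.

(** * Splitting a 231-avoiding word at its maximum *)

Definition glue n (l r : seq nat) := l ++ n :: map (addn (size l)) r.

Lemma index_glue n (l r : seq nat) : {in l, forall x, x < n} -> index n (glue n l r) = size l.
Proof.
move=> ltl; rewrite index_cat /= eqxx addn0 ifN //.
by apply/negP => /ltl; rewrite ltnn.
Qed.

Lemma glue_words n j (l r : seq nat) : j <= n ->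
  l \in words j -> r \in words (n - j) -> glue n l r \in words n.+1.
Proof.
move=> lejn; rewrite !mem_words => /andP[avl pl] /andP[avr pr].
have szl := size_word pl.
have ltl := word_lt pl; have ltr := word_lt pr.
rewrite av_max ?av_addn ?avl ?avr ?andbT; last first.
- by move=> _ /mapP[x /ltr + ->]; rewrite szl; lia.
- by move=> x /ltl; lia.
apply/andP; split.
  by apply/allrelP => x _ /ltl ltx /mapP[y _ ->]; rewrite szl (leq_trans (ltnW ltx)) ?leq_addr.
rewrite perm_cat_max -[n in iota 0 n](subnKC lejn) iotaD perm_cat //.
by rewrite szl add0n -[X in iota X _]addn0 iotaDl perm_map.
Qed.

Lemma unglue n (w : seq nat) : w \in words n.+1 ->
  exists l r, [/\ w = glue n l r, size l <= n, l \in words (size l)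
                & r \in words (n - size l)].
Proof.
rewrite mem_words => /andP[avw pw].
have nw : n \in w by rewrite (perm_mem pw) mem_iota /=.
case/splitPr: nw pw avw => l r' pw.
have plr : perm_eq (l ++ r') (iota 0 n).
  by rewrite -perm_cat_max.
have lt_lr := word_lt plr.
have ltl : {in l, forall x, x < n} by move=> x xl; apply: lt_lr; rewrite mem_cat xl.
have ltr : {in r', forall x, x < n}.
  by move=> x xr; apply: lt_lr; rewrite mem_cat xr orbT.
rewrite av_max // => /and3P[lelr avl avr].
have szlr := size_word plr; rewrite size_cat in szlr.
have lejn : size l <= n by lia.
(* Sorting both halves of a word whose left half lies below its right half
   sorts the word, so the halves are intervals. *)
have sorted_lr : sort leq l ++ sort leq r' = iota 0 n.
  apply: (sorted_eq leq_trans anti_leq) => //.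
  - rewrite (sorted_pairwise leq_trans) pairwise_cat.
    rewrite -!(sorted_pairwise leq_trans) !(sort_sorted leq_total) !andbT.
    by apply/allrelP => x y; rewrite !mem_sort; apply: (allrelP lelr).
  - exact: iota_sorted.
  by apply: perm_trans plr; rewrite perm_cat // perm_sort.
rewrite -[n in iota 0 n](subnKC lejn) iotaD add0n in sorted_lr.
move/eqP: sorted_lr; rewrite eqseq_cat ?size_sort ?size_iota // => /andP[/eqP sl /eqP sr].
have pl : perm_eq l (iota 0 (size l)) by rewrite -sl perm_sym perm_sort.
have pr : perm_eq r' (iota (size l) (n - size l)) by rewrite -sr perm_sym perm_sort.
have r'E : r' = map (addn (size l)) (map (subn^~ (size l)) r').
  rewrite -map_comp map_id_in // => x; rewrite (perm_mem pr) mem_iota => /andP[lex _] /=.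
  exact: subnKC.
exists l, (map (subn^~ (size l)) r'); split=> //.
- by rewrite /glue -r'E.
- by rewrite mem_words avl pl.
rewrite mem_words -(av_addn (size l)) -r'E avr.
apply: (perm_map_inj (@addnI (size l))); rewrite -r'E.
by rewrite -iotaDl addn0.
Qed.

(** [glue] is a bijection from pairs of words onto the words whose maximum is in
position [j]; the predicate [Q] on the left part is carried along because
winnability depends on the left part alone. *)
Lemma count_words n j (Q : pred (seq nat)) : j <= n ->
  count (fun w => (index n w == j) && Q (take j w)) (words n.+1)
  = count Q (words j) * size (words (n - j)).
Proof.
move=> lejn; rewrite -!size_filter -(size_allpairs (glue n)).
apply/perm_size/uniq_perm.
- by rewrite filter_uniq ?uniq_words.
- apply: allpairs_uniq; [by rewrite filter_uniq ?uniq_words | exact: uniq_words | ].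
  move=> _ _ /allpairsPdep[l1 [r1 [+ _ ->]]] /allpairsPdep[l2 [r2 [+ _ ->]]].
  rewrite !(mem_filter Q) !mem_words => /and3P[_ _ /size_word s1] /and3P[_ _ /size_word s2] /= /eqP.
  rewrite eqseq_cat ?s1 ?s2 // => /andP[/eqP -> /eqP[]].
  by move/(inj_map (@addnI j)) ->.
move=> w; rewrite mem_filter; apply/idP/allpairsP.
  case/andP=> /andP[/eqP jw Qw] /unglue[l [r [wE lel lw rw]]].
  have szl : size l = j.
    move: lw; rewrite -jw wE mem_words => /andP[_ /word_lt ltl].
    by rewrite index_glue // => x /ltl ltx; apply: leq_trans ltx lel.
  exists (l, r); rewrite -szl /=; split=> //.
  by rewrite (mem_filter Q) lw andbT; move: Qw; rewrite wE -szl take_size_cat.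
case=> [[l r] /= [+ rw ->]]; rewrite (mem_filter Q) => /andP[Ql lw].
rewrite (glue_words _ _ _ _ lejn) // andbT.
move: lw; rewrite mem_words => /andP[_ pl].
rewrite index_glue ?(size_word pl) ?eqxx /=; last first.
  by move=> x /(word_lt pl) ltx; apply: leq_trans ltx lejn.
by rewrite /glue take_cat (size_word pl) ltnn subnn take0 cats0.
Qed.

(** * Counting words by the position of the maximum *)

Lemma perm_take_index n (w : seq nat) : w \in words n.+1 ->
  perm_eq (take (index n w) w) (iota 0 (index n w)).
Proof.
case/unglue=> l [r [-> lel + _]]; rewrite mem_words => /andP[_ pl].
rewrite index_glue ?take_size_cat // => x /(word_lt pl) ltx.
exact: leq_trans ltx lel.
Qed.

Lemma countE (T : Type) (P : pred T) s : count P s = \sum_(w <- s) P w.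
Proof. by rewrite -sum1_count big_mkcond; apply: eq_bigr => w _; case: (P w). Qed.

Lemma count_index n (P : pred (seq nat)) : count P (words n.+1)
  = \sum_(j < n.+1) count (fun w => (index n w == j) && P w) (words n.+1).
Proof.
rewrite countE; under [RHS]eq_bigr => j _ do rewrite countE.
rewrite exchange_big /= big_seq [RHS]big_seq; apply: eq_bigr => w.
rewrite mem_words => /andP[_ pw].
have ltn_w : index n w < n.+1.
  by rewrite -[X in _ < X](size_word pw) index_mem (perm_mem pw) mem_iota ltnSn.
rewrite (bigD1 (Ordinal ltn_w)) //= eqxx big1 ?addn0 // => j neqj.
by case: eqP => // eqj; case/eqP: neqj; apply: val_inj.
Qed.

Lemma count_index_eq n j : j <= n ->
  count (fun w => index n w == j) (words n.+1)
  = size (words j) * size (words (n - j)).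
Proof.
move=> lejn; rewrite -[in RHS](count_predT (words j)) -count_words //.
by apply: eq_count => w; rewrite andbT.
Qed.

Lemma size_wordsS n : size (words n.+1)
  = \sum_(j < n.+1) size (words j) * size (words (n - j)).
Proof.
rewrite -(count_predT (words n.+1)) count_index; apply: eq_bigr => j _.
rewrite -count_index_eq; last by rewrite -ltnS.
by apply: eq_count => w; rewrite andbT.
Qed.

Lemma size_words n : size (words n) = catalan n.
Proof.
elim/ltn_ind: n => -[//|n] IHn; rewrite size_wordsS catalanS.
apply: eq_bigr => j _; rewrite !IHn //; have := ltn_ord j; lia.
Qed.

(** * Independence of k *)

(** The [k]-winnability of a 231-avoiding word: the entries before the maximum
[n], in position [j], are [0, ..., j.-1], so [j.-1] is the value that must have
been rejected.  If [j = 0], only the first disjunct can hold, so the value of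
[j.-1] does not matter. *)
Definition selects n k w :=
  let j := index n w in (j == k) || (k < j) && (index j.-1 w < k).

Lemma index_left_max {n} {w : seq nat} : w \in words n.+1 -> 0 < index n w ->
  index (index n w).-1 w < index n w.
Proof.
move=> /perm_take_index pj j0; set j := index n w in pj j0 *.
have jl : j.-1 \in take j w by rewrite (perm_mem pj) mem_iota; lia.
rewrite -[w in index _ w](cat_take_drop j) index_cat jl.
by rewrite -[X in _ < X](size_word pj) index_mem.
Qed.

(** Splitting the word at [n] and then its left part at [j.-1] gives three
blocks of lengths [k], [j.-1 - k] and [n - j]; the last two are recombined by
the Catalan recurrence, read backwards. *)
Lemma count_left_max n k : k < n ->
  count (fun w => let j := index n w in (k < j) && (index j.-1 w == k)) (words n.+1)
  = size (words k) * size (words (n - k)).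
Proof.
move=> ltkn; rewrite count_index.
have term (j : 'I_n.+1) : true ->
    count (fun w => (index n w == j)
       && (k < index n w) && (index (index n w).-1 w == k)) (words n.+1)
    = if k < j then size (words k) * (size (words (j.-1 - k)) * size (words (n - j)))
      else 0.
  move=> _; have lej : j <= n by rewrite -ltnS.
  case: ltnP => [ltkj|lejk]; last first.
    rewrite -(count_pred0 (words n.+1)); apply: eq_count => w /=.
    by apply/negP => /andP[/andP[/eqP ->]]; rewrite ltnNge lejk.
  have j1 : j = j.-1.+1 :> nat by rewrite prednK //; apply: leq_trans ltkj.
  rewrite mulnA -count_index_eq; last by rewrite -ltnS -j1.
  rewrite -j1 -count_words //; apply: eq_in_count => w wn /=.
  case: eqP => //= jw; have := index_left_max wn; have := perm_take_index _ _ wn.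
  rewrite jw ltkj /= => pj /(_ (leq_trans (ltn0Sn k) ltkj)) _.
  have jl : j.-1 \in take j w by rewrite (perm_mem pj) mem_iota; lia.
  by rewrite -{1}(cat_take_drop j w) index_cat jl.
under eq_bigr => j _ do (under eq_count => w do rewrite /= andbA; rewrite term //).
rewrite -big_mkcond -big_distrr /=; congr (_ * _).
have -> : n - k = (n - k.+1).+1 by lia.
rewrite size_wordsS.
rewrite -(big_mkord (fun j => k < j)
  (fun j => size (words (j.-1 - k)) * size (words (n - j)))).
rewrite (big_cat_nat (n := k.+1)) ?(leqW ltkn) //= big_nat_cond big_pred0 ?add0n; last first.
  by move=> j; lia.
rewrite -[k.+1 in LHS]add0n big_addn -(big_mkord xpredT
  (fun j => size (words j) * size (words (n - k.+1 - j)))).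
rewrite (_ : n.+1 - k.+1 = (n - k.+1).+1); last by lia.
apply: eq_big => [j|j _]; first by lia.
by congr (size (words _) * size (words _)); lia.
Qed.

(** Passing from [k] to [k.+1] loses the words with [n] in position [k] and gains
those with the left maximum in position [k]; there are equally many of both. *)
Lemma count_selects n k : k <= n ->
  count (selects n k) (words n.+1) = size (words n).
Proof.
elim: k => [_|k IHk ltkn].
  transitivity (size (words 0) * size (words n)); last by rewrite /= mul1n.
  rewrite -[n in RHS]subn0 -count_index_eq //; apply: eq_count => w.
  by rewrite /selects ltn0 andbF orbF.
rewrite -(IHk (ltnW ltkn)).
apply/eqP; rewrite -(eqn_add2r (size (words k) * size (words (n - k)))).
rewrite -{1}(count_index_eq n k (ltnW ltkn)) -(count_left_max n k ltkn) !countE -!big_split /=.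
(* Word by word, the two sides agree because the left maximum precedes [n];
   this matters when [n] is in position [k.+1]. *)
apply/eqP; rewrite big_seq [RHS]big_seq; apply: eq_bigr => w wn.
have := index_left_max wn; rewrite /selects.
move: (index n w) => j; move: (index _ w) => m; lia.
Qed.

(** * From permutations to words *)

Definition word {N} (p : 'S_N) : seq nat := [seq val (p i) | i <- enum 'I_N].

Lemma size_word_of_perm {N} (p : 'S_N) : size (word p) = N.
Proof. by rewrite size_map size_enum_ord. Qed.

Lemma nth_word {N} (p : 'S_N) (i : 'I_N) : nth 0 (word p) i = p i.
Proof. by rewrite (nth_map i) ?size_enum_ord ?nth_ord_enum. Qed.

Lemma index_word {N} (p : 'S_N) (i : 'I_N) : index (p i : nat) (word p) = i.
Proof.
rewrite /word (index_map (f := fun i => val (p i))) ?index_enum_ord //.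
by move=> x y /val_inj /perm_inj.
Qed.

Lemma perm_eq_word {N} (p : 'S_N) : perm_eq (word p) (iota 0 N).
Proof.
rewrite -val_enum_ord /word (map_comp val p); apply/perm_map/uniq_perm.
- by rewrite map_inj_uniq ?enum_uniq //; apply: perm_inj.
- exact: enum_uniq.
by move=> i; rewrite mem_enum -[i in LHS](permKV p) map_f // mem_enum.
Qed.

Lemma card_word N (P : pred (seq nat)) :
  #|[set p : 'S_N | P (word p)]| = count P (permutations (iota 0 N)).
Proof.
rewrite cardsE cardE /enum_mem size_filter -enumT.
transitivity (count P (map word (enum 'S_N))).
  by rewrite count_map.
have inj_word : injective (@word N).
  by move=> p q eqw; apply/permP => i; apply: val_inj; rewrite /= -!nth_word eqw.
have uw : uniq (map word (enum 'S_N)) by rewrite map_inj_uniq // enum_uniq.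
have sub : {subset map word (enum 'S_N) <= permutations (iota 0 N)}.
  by move=> _ /mapP[p _ ->]; rewrite mem_permutations perm_eq_word.
apply/seq.permP/uniq_perm; rewrite ?permutations_uniq //.
apply: (uniq_min_size uw sub _).2.
by rewrite size_permutations ?iota_uniq // size_iota size_map -cardE card_Sn.
Qed.

Lemma avoids231 {N} (p : 'S_N) : avoids p 2 3 1 = av (word p).
Proof.
apply/idP/avP => [avp i j k /andP[ltij ltjk]|avw].
  rewrite size_word_of_perm => ltk; have ltj := ltn_trans ltjk ltk.
  have lti := ltn_trans ltij ltj; apply: contra avp => /andP[ltki ltij'].
  apply/existsP; exists (Ordinal lti); apply/existsP; exists (Ordinal ltj).
  apply/existsP; exists (Ordinal ltk); rewrite -!nth_word /=.
  by rewrite ltij ltjk ltij' !eqbF_neg -!leqNgt (ltnW ltki) (ltnW (ltn_trans ltki ltij')).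
apply/negP => /existsP[i /existsP[j /existsP[k /and5P[ltij ltjk]]]].
rewrite eqb_id !eqbF_neg -!leqNgt => pij pki _.
have /negP[] : ~~ (nth 0 (word p) k < nth 0 (word p) i < nth 0 (word p) j).
  by apply: avw; rewrite ?ltij ?size_word_of_perm.
rewrite !nth_word pij andbT ltn_neqAle pki andbT.
by rewrite (inj_eq val_inj) (inj_eq perm_inj); apply/eqP => ki; rewrite ki in ltjk; lia.
Qed.

(** Let [j] be the position of [n], and suppose [k < j]; let [m] be the position of
[j.-1], the largest entry before [n].  The entry in position [m] is a left-to-right maximum, and none follows it
before [j]; so there is none among the positions from [k] up to [j] exactly when
[m < k]. *)
Lemma winnable_selects n k (p : 'S_n.+1) : av (word p) ->
  winnable k p = selects n k (word p).
Proof.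
move=> avp; have wn : word p \in words n.+1 by rewrite mem_words avp perm_eq_word.
have [j pj] : exists j, p j = ord_max by exists ((p^-1)%g ord_max); rewrite permKV.
have jE : index n (word p) = j by rewrite -(index_word p j) pj.
have pE : winnable k p
    = (k <= j) && [forall i : 'I_n.+1, (k <= i < j) ==> ~~ lr_max p i].
  apply/existsP/andP => [[j' /and4P[lekj' _ nolr /eqP[pj']]]|[lekj nolr]].
    by have <- : j' = j by apply: (@perm_inj _ p); apply: val_inj; rewrite pj /= pj'.
  exists j; rewrite lekj nolr pj eqxx /= andbT; apply/forallP => i; apply/implyP => ltij.
  rewrite pj /= ltn_neqAle -ltnS ltn_ord andbT.
  apply/eqP => pi; have ij : i = j by apply: (@perm_inj _ p); apply: val_inj; rewrite pj.
  by rewrite ij ltnn in ltij.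
rewrite pE /selects jE; case: (ltngtP k j) => //= [ltkj|<-]; last first.
  by apply/forallP => i; apply/implyP; rewrite ltnNge andbN.
have := perm_take_index _ _ wn; have := index_left_max wn.
rewrite jE => /(_ (leq_trans (ltn0Sn k) ltkj)) + pl.
have ltpj (i : 'I_n.+1) : i < j -> p i < j.
  move=> ltij; apply: (word_lt pl); rewrite -nth_word -(nth_take 0 ltij).
  by apply: mem_nth; rewrite (size_word pl).
have ltj1 : j.-1 < n.+1 by apply: leq_ltn_trans (leq_pred _) (ltn_ord j).
have [m pm] : exists m, p m = Ordinal ltj1.
  by exists ((p^-1)%g (Ordinal ltj1)); rewrite permKV.
have -> : index j.-1 (word p) = m by rewrite -(index_word p m) pm.
move=> ltmj.
have ltpm (i : 'I_n.+1) : i < j -> i != m -> p i < p m.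
  move=> /ltpj ltpij neqim; have : p i != p m by rewrite (inj_eq perm_inj).
  rewrite -(inj_eq val_inj) pm /=; lia.
apply/forallP/idP => [nolr|ltmk i].
  rewrite ltnNge; apply/negP => lekm.
  have /implyP := nolr m; rewrite lekm ltmj => /(_ isT) /negP[].
  apply/forallP => i; apply/implyP => ltim; apply: ltpm; first exact: ltn_trans ltmj.
  by apply/eqP => im; rewrite im ltnn in ltim.
apply/implyP => /andP[leki ltij]; apply/negP => /forallP/(_ m)/implyP.
have ltmi := leq_trans ltmk leki => /(_ ltmi).
rewrite ltnNge ltnW // ltpm //.
by apply/eqP => im; rewrite im ltnn in ltmi.
Qed.

Theorem corollary3p2 (N k : nat) (hN : 1 <= N) (hk : k <= N - 1) :
  #|[set p : 'S_N | avoids p 2 3 1 && winnable k p]| = catalan (N - 1).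
Proof.
case: N hN hk => [//|n] _; rewrite subn1 /= => lekn.
rewrite -size_words -(count_selects n k lekn) count_filter -card_word.
apply: eq_card => p; rewrite !inE avoids231 andbC.
by case: (boolP (av _)) => [/winnable_selects -> //|_]; rewrite !andbF.
Qed.
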